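(* Let $(X, \tau, <)$ be a GO-space with a $\sigma$-closed-discrete dense subset. Then the following are equivalent: (a) $(X, \tau)$ is monotonically metacompact; (b) $(X, \tau)$ is monotonically countably metacompact; (c) $(X, \tau)$ is metrizable.
   Context: A GO-space (generalized ordered space) is a triple $(X, \tau, <)$ where $<$ is a linear ordering of the set $X$ and $\tau$ is a Hausdorff topology on $X$ that has a base of convex subsets of $(X,<)$, possibly including some singletons. A subset of a space is closed-discrete if every point of the space has a neighborhood containing at most one point of the subset; it is $\sigma$-closed-discrete if it is a countable union of closed-discrete subsets. Here the dense subset is dense and $\sigma$-closed-discrete with respect to $\tau$. For two collections of sets $\mathcal{U}$ and $\mathcal{V}$, write $\mathcal{U} \prec \mathcal{V}$ if for each $U \in \mathcal{U}$ there is some $V \in \mathcal{V}$ with $U \subseteq V$. A space $X$ is monotonically metacompact (respectively, monotonically countably metacompact), in the sense of Popvassilev, if there is a function $r$ that associates with each open cover (respectively, each countable open cover) $\mathcal{U}$ of $X$ a point-finite collection $r(\mathcal{U})$ of open sets that covers $X$ and satisfies $r(\mathcal{U}) \prec \mathcal{U}$, in such a way that if $\mathcal{U}$ and $\mathcal{V}$ are open covers (respectively, countable open covers) of $X$ with $\mathcal{U} \prec \mathcal{V}$, then $r(\mathcal{U}) \prec r(\mathcal{V})$. (In the countable version, $r(\mathcal{U})$ is not required to be countable.) *)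

(* Defs.v *)
From mathcomp Require Import all_boot all_order all_algebra.
From mathcomp Require Import all_classical all_reals topology.

Set Implicit Arguments.
Unset Strict Implicit.
Unset Printing Implicit Defensive.

Import Order.TTheory GRing.Theory Num.Theory.

Local Open Scope classical_set_scope.

Definition order_convex d (T : porderType d) (C : set T) : Prop :=
  forall x y z : T, C x -> C y -> (x <= z <= y)%O -> C z.

(* [POrderedTopological.type] relates the order and the topology in no way, and
   [orderTopologicalType] would be too restrictive: the topology of a GO-space
   may be strictly finer than the one generated by the open intervals (e.g. the
   Sorgenfrey line). *)
Definition GO_space d (X : POrderedTopological.type d) : Prop :=
  [/\ total (<=%O : rel X),
      hausdorff_space X &
      exists2 B : set (set X), basis B & forall C, B C -> order_convex C].

Section Collections.
Context {X : topologicalType}.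
Implicit Types (D : set X) (U V : set (set X)).

Definition closed_discrete D : Prop :=
  forall x : X, exists2 N : set X, nbhs x N & is_subset1 (N `&` D).

Definition sigma_closed_discrete D : Prop :=
  exists2 F : nat -> set X,
    (forall n, closed_discrete (F n)) & D = \bigcup_n F n.

Definition refines U V : Prop :=
  forall A, U A -> exists2 B, V B & A `<=` B.

Definition open_cover U : Prop :=
  U `<=` open /\ \bigcup_(A in U) A = setT.

Definition point_finite U : Prop :=
  forall x : X, finite_set [set A | U A /\ A x].

(* [K] is the class of open covers on which [r] operates; the values of [r]
   outside of [K] are irrelevant. *)
Definition monotone_point_finite_refinement
    (K : set (set (set X))) (r : set (set X) -> set (set X)) : Prop :=
  (forall U, K U ->
     [/\ open_cover (r U), point_finite (r U) & refines (r U) U]) /\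
  (forall U V, K U -> K V -> refines U V -> refines (r U) (r V)).

End Collections.

Definition monotonically_metacompact (X : topologicalType) : Prop :=
  exists r, monotone_point_finite_refinement
    [set U : set (set X) | open_cover U] r.

Definition monotonically_countably_metacompact (X : topologicalType) : Prop :=
  exists r, monotone_point_finite_refinement
    [set U : set (set X) | open_cover U /\ countable U] r.

(* [m] is a metric structure on the carrier of [X], a priori unrelated to the
   given topology of [X]. *)
Definition metrizable (R : realType) (X : topologicalType) : Prop :=
  exists m : Metric.axioms_ R X,
    forall A : set X, @open X A <-> @open (Metric.Pack m) A.

(* Main.v *)
(* From metrizable to monotonically metacompact: a metrizable space has, by
   Stone's theorem, a development by successively refining point-finite open
   covers G_n, and r(U) consists of the members of the G_n that are inside some
   member of U but in no member of an earlier G_k that is.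

   From monotonically countably metacompact to metrizable: let x be such that
   [x,->) is open, and let V_x contain x and belong to the refinement of the
   cover {(<-,x), [x,->)}. Monotonicity prevents infinitely many x decreasing
   from a point of all the V_x, hence the points x for which V_x reaches a
   fixed closed-discrete set do not accumulate from the right; in each gap to
   their right lies a point of the dense set, so they form a
   sigma-closed-discrete set. The same holds for the points with open left ray.
   Finally, an increasing sequence of closed-discrete sets G_n with dense union,
   G_(n+1) containing a point between any two non-adjacent points of G_n,
   together with the clopen cuts just described, gives a countable uniformity:
   x and y are n-close when the interval between them contains at most one
   point of G_n and crosses none of the first n families of clopen cuts. *)

Require Import Defs.
From HB Require Import structures.
From mathcomp Require Import all_boot all_order all_algebra lra.
From mathcomp Require Import all_classical wochoice all_reals topology.

Set Implicit Arguments.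
Unset Strict Implicit.
Unset Printing Implicit Defensive.

Import Order.TTheory GRing.Theory Num.Theory.

Local Open Scope classical_set_scope.
Local Open Scope ring_scope.

(** * Metric structures as plain distance functions *)

Section Metrics.
Context {R : realType}.

Definition is_metric (T : Type) (dist : T -> T -> R) : Prop :=
  [/\ forall x y, dist x y = 0 <-> x = y,
      forall x y, dist x y = dist y x &
      forall y x z, dist x z <= dist x y + dist y z].

Definition induces_topology (X : topologicalType) (dist : X -> X -> R) : Prop :=
  forall A : set X, open A <->
    forall x, A x -> exists2 e, 0 < e & forall y, dist x y < e -> A y.

Lemma open_mdist (M : metricType R) : induces_topology (@mdist R M).
Proof.
move=> A; rewrite openE; split => oA x Ax.
  have /nbhs_ballP[e e0 eA] := oA x Ax; exists e => // y xy.
  by apply: eA; rewrite ballEmdist.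
have [e e0 eA] := oA x Ax; apply/nbhs_ballP; exists e => // y.
by rewrite ballEmdist => /eA.
Qed.

(* A copy of the carrier without topology, on which a metric structure can be
   built from [dist]. *)
Definition metric_copy (T : choiceType) (dist : T -> T -> R)
  (hd : is_metric dist) : Type := T.

Section MetricCopy.
Context (T : choiceType) (dist : T -> T -> R) (hd : is_metric dist).

HB.instance Definition _ := Choice.copy (metric_copy hd) T.

Let distxx (x : metric_copy hd) : dist x x = 0.
Proof. by have [d0 _ _] := hd; apply/d0. Qed.

Let dist_pos (x y : metric_copy hd) : dist x y = 0 -> x = y.
Proof. by have [d0 _ _] := hd; move/d0. Qed.

Let distC (x y : metric_copy hd) : dist x y = dist y x.
Proof. by have [] := hd. Qed.

Let dist_triangle (y x z : metric_copy hd) : dist x z <= dist x y + dist y z.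
Proof. by have [] := hd. Qed.

HB.instance Definition _ := isMetric.Build R (metric_copy hd)
  distxx dist_pos distC dist_triangle.

End MetricCopy.

Lemma metrizableP (X : topologicalType) :
  metrizable R X <->
  exists2 dist : X -> X -> R, is_metric dist & induces_topology dist.
Proof.
split=> [[m mE]|[dist hd distE]].
  pose M : metricType R := Metric.Pack m.
  exists (@mdist R M).
    split=> [x y|x y|y x z].
    - by split=> [/mdist_positivity//|->]; exact: mdistxx.
    - exact: (@metric_sym R M).
    - exact: (@metric_triangle R M).
  by move=> A; rewrite mE; apply: (@open_mdist M).
exists (Metric.class (metric_copy hd : metricType R)) => A.
rewrite distE.
exact: iff_sym (@open_mdist (metric_copy hd) A).
Qed.

End Metrics.

(** * The chain metric of a countable uniformity *)

Section DyadicMetrization.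
Context {R : realType} {T : Type} (W : nat -> T -> T -> Prop).
Hypothesis W_refl : forall n x, W n x x.
Hypothesis W_sym : forall n x y, W n x y -> W n y x.
Hypothesis W_comp : forall n x y z w,
  W n.+1 x y -> W n.+1 y z -> W n.+1 z w -> W n x w.
Hypothesis W_sep : forall x y, (forall n, W n x y) -> x = y.

Local Notation half n := ((2^-1 : R) ^+ n).

Let half_gt0 n : 0 < half n. Proof. by rewrite exprn_gt0 ?invr_gt0. Qed.

Let half_lt1 : 0 < (2^-1 : R) < 1.
Proof. by apply/andP; split; lra. Qed.

Let halfS n : half n.+1 = half n / 2. Proof. by rewrite exprS mulrC. Qed.

Let W_anti m n x y : (n <= m)%N -> W m x y -> W n x y.
Proof.
move=> /subnK <-; elim: (m - n)%N => [//|k IH]; rewrite addSn => Wk.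
by apply: IH; apply: (W_comp Wk).
Qed.

Let exB (P : nat -> Prop) : (exists n, ~ P n) -> exists n, `[< ~ P n >].
Proof. by move=> [n Pn]; exists n; apply/asboolP. Qed.

(** The [W n] decrease with [n], so the first failing level, coded as a power of one half,
    determines all levels that hold. *)
Let depth (P : nat -> Prop) : R :=
  if pselect (exists n, ~ P n) is left h then half (ex_minn (exB h)) else 0.

Let rho x y := depth (fun n => W n x y).

Let rhoP n x y : rho x y < half n <-> W n x y.
Proof.
rewrite /rho /depth; case: pselect => [h|h]; last first.
  by split=> // _; apply: contrapT => Wn; apply: h; exists n.
case: ex_minnP => k /asboolP Wk kmin; split => [kn|Wn].
  apply: contrapT => Wn; move/asboolP: Wn => /kmin nk; move: kn.
  by have /andP[? ?] := half_lt1; rewrite ltNge ler_iXn2l ?nk.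
have nk : (n < k)%N by rewrite ltnNge; apply/negP => /W_anti /(_ Wn).
by have /andP[? ?] := half_lt1; rewrite ltr_iXn2l.
Qed.

Let rho_ge0 x y : 0 <= rho x y.
Proof. by rewrite /rho /depth; case: pselect => // h; apply: ltW. Qed.

Let rho_sym x y : rho x y = rho y x.
Proof.
by congr depth; apply/funext => n; apply/propext; split; apply: W_sym.
Qed.

(** [rho] may violate the triangle inequality; the infimum of chain lengths satisfies it. *)
Fixpoint chain_len (x : T) (l : seq T) : R :=
  if l is y :: l' then rho x y + chain_len y l' else 0.

Let chain_len_cat x l1 l2 :
  chain_len x (l1 ++ l2) = chain_len x l1 + chain_len (last x l1) l2.
Proof. by elim: l1 x => [|y l IH] x /=; rewrite ?add0r// IH addrA. Qed.

Let chain_len_ge0 x l : 0 <= chain_len x l.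
Proof. by elim: l x => //= y l IH x; rewrite addr_ge0. Qed.

Let chain_len_rev x l : exists2 l',
  last (last x l) l' = x & chain_len (last x l) l' = chain_len x l.
Proof.
elim: l x => [|y l IH] x /=; first by exists [::].
have [l' lastl' lenl'] := IH y; exists (rcons l' x); first by rewrite last_rcons.
by rewrite -cats1 chain_len_cat lenl' lastl' /= addr0 addrC rho_sym.
Qed.

Let chain_split x l t : (0 < size l)%N -> 0 <= t <= chain_len x l ->
  exists l1 z l2, [/\ l = l1 ++ z :: l2, chain_len x l1 <= t &
    t <= chain_len x l1 + rho (last x l1) z].
Proof.
elim: l x t => [//|y l IH] x t _ /= /andP[t0 tl].
have [txy|xyt] := leP t (rho x y).
  by exists [::], y, l; rewrite /= add0r.
have [l0|l0] := posnP (size l).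
  by move: tl; rewrite (size0nil l0) /= addr0 leNgt xyt.
have [||l1 [z [l2 [-> l1t tl1]]]] := IH y (t - rho x y) => //.
  by rewrite subr_ge0 (ltW xyt) lerBlDl.
exists (y :: l1), z, l2; split => //=; first by rewrite -lerBrDl.
by rewrite -addrA -lerBlDl.
Qed.

(** Cut the chain at the link that passes half of its length. The parts before and after have at
    most half the length, so induction on the number of links applies one level deeper; the link
    itself has [rho] below [half n.+1]. The threefold [W_comp] joins the pieces. *)
Let chain_W n x l : chain_len x l < half n.+1 -> W n x (last x l).
Proof.
have [k] := ubnP (size l); elim: k n x l => // k IH n x l lk lenl.
have [l0|l0] := posnP (size l); first by rewrite (size0nil l0).
have len0 := chain_len_ge0 x l.
have [|l1 [z [l2 [lE l1t tl1]]]] := @chain_split x l (chain_len x l / 2) l0.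
  by lra.
move: lenl len0 l1t tl1 lk.
rewrite lE chain_len_cat last_cat size_cat /= => lenl len0 l1t tl1 lk.
have g1 := chain_len_ge0 x l1; have g2 := chain_len_ge0 z l2.
have g3 := rho_ge0 (last x l1) z.
apply: (@W_comp _ _ (last x l1) z).
- apply: IH; last by rewrite (halfS n.+1); lra.
  by move: lk; rewrite addnS ltnS; apply: leq_trans; rewrite ltnS leq_addr.
- by apply/rhoP; lra.
- apply: IH; last by rewrite (halfS n.+1); lra.
  by move: lk; rewrite addnS ltnS; apply: leq_trans; rewrite ltnS leq_addl.
Qed.

Let dist x y : R := inf [set chain_len x l | l in [set l | last x l = y]].

Let dist_le x l : dist x (last x l) <= chain_len x l.
Proof.
apply: ge_inf; last by exists l.
by exists 0 => _ [l' _ <-].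
Qed.

Let dist_ge0 x y : 0 <= dist x y.
Proof.
apply: lb_le_inf; first by exists (chain_len x [:: y]), [:: y].
by move=> _ [l _ <-].
Qed.

Let dist_lt x y e : dist x y < e -> exists2 l, last x l = y & chain_len x l < e.
Proof.
move=> xye; apply: contrapT => nl; move: xye; rewrite ltNge => /negP; apply.
apply: lb_le_inf; first by exists (chain_len x [:: y]), [:: y].
by move=> _ [l ly <-]; rewrite leNgt; apply/negP => le; apply: nl; exists l.
Qed.


(* The metrization lemma of Frink, Alexandroff-Urysohn and Weil. *)
Lemma dyadic_metrization : exists dist : T -> T -> R, [/\ is_metric dist,
  forall n x y, dist x y < (2^-1) ^+ n.+1 -> W n x y &
  forall n x y, W n x y -> dist x y < (2^-1) ^+ n].
Proof.
have distW n x y : dist x y < half n.+1 -> W n x y.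
  by move=> /dist_lt[l <-]; apply: chain_W.
have dist_symle x y : dist x y <= dist y x.
  apply/ler_addgt0Pr => e e0.
  have [|l lx le] := @dist_lt y x (dist y x + e); first by rewrite ltrDl.
  rewrite -lx; have [l' l'y l'len] := chain_len_rev y l.
  have := dist_le (last y l) l'; rewrite l'y l'len.
  by move=> /le_trans; apply; rewrite ltW// lx.
exists dist; split => //.
  split=> [x y|x y|y x z].
  - split=> [xy|->].
      by apply: W_sep => n; apply: distW; rewrite xy.
    by apply/eqP; rewrite eq_le dist_ge0 andbT; apply: (dist_le y [::]).
  - by apply/eqP; rewrite eq_le !dist_symle.
  - apply/ler_addgt0Pr => e e0.
    have e20 : 0 < e / 2 by rewrite divr_gt0.
    have [|l1 l1y l1e] := @dist_lt x y (dist x y + e / 2).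
      by rewrite ltrDl.
    have [|l2 l2z l2e] := @dist_lt y z (dist y z + e / 2).
      by rewrite ltrDl.
    have := dist_le x (l1 ++ l2); rewrite last_cat l1y l2z chain_len_cat l1y; lra.
move=> n x y /rhoP; apply: le_lt_trans.
by have := dist_le x [:: y]; rewrite /= addr0.
Qed.

End DyadicMetrization.

(** * Metrizability from a sequence of entourages *)

Section Metrizability.
Context {R : realType} {X : topologicalType}.

Lemma exp_half_lt (e : R) : 0 < e -> exists n, (2^-1 : R) ^+ n < e.
Proof.
move=> e0; exists (Num.truncn e^-1).+1.
rewrite exprVn invf_plt ?posrE ?exprn_gt0//.
apply: (lt_le_trans (truncnS_gt _)).
by rewrite -natrX ler_nat ltnW// ltn_expl.
Qed.

Lemma metrizable_entourages (W : nat -> X -> X -> Prop) :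
  hausdorff_space X ->
  (forall n x, W n x x) -> (forall n x y, W n x y -> W n y x) ->
  (forall n x y z w,
    W n.+1 x y -> W n.+1 y z -> W n.+1 z w -> W n x w) ->
  (forall n x, nbhs x (W n x)) ->
  (forall x O, nbhs x O -> exists n, W n x `<=` O) ->
  metrizable R X.
Proof.
move=> hX Wr Ws Wc Wn Wb; apply/metrizableP.
have [|dist [hd dW Wd]] := @dyadic_metrization R X W Wr Ws Wc.
  (* Such a [y] lies in every neighbourhood of [x]. *)
  move=> x y xy; apply: hX => A B xA yB.
  have [n nA] := Wb x A xA; exists y; split; first by apply: nA.
  exact: nbhs_singleton.
exists dist => // A; rewrite openE; split => oA x Ax.
  have [n nA] := Wb x A (oA x Ax).
  exists ((2^-1) ^+ n.+1); first by rewrite exprn_gt0 ?invr_gt0.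
  by move=> y /dW /nA.
have [e e0 eA] := oA x Ax; have [n ne] := exp_half_lt e0.
apply: filterS (Wn n x) => y /Wd xy; apply: eA; exact: lt_trans ne.
Qed.

End Metrizability.

(** * Stone's theorem and point-finite developments *)

Section MetricMetacompact.
Context {R : realType} {X : topologicalType} (dist : X -> X -> R).
Hypotheses (hd : is_metric dist) (hopen : induces_topology dist).

Local Notation half n := ((2^-1 : R) ^+ n).

Definition dball (x : X) (e : R) : set X := [set y | dist x y < e].

Let distC x y : dist x y = dist y x. Proof. by have [] := hd. Qed.

Let distxx x : dist x x = 0. Proof. by have [d0 _ _] := hd; apply/d0. Qed.

Let dist_tri y x z : dist x z <= dist x y + dist y z.
Proof. by have [] := hd. Qed.

Let half_gt0 n : 0 < half n. Proof. by rewrite exprn_gt0 ?invr_gt0. Qed.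

Let half_le m n : (m <= n)%N -> half n <= half m.
Proof. by move=> mn; rewrite ler_iXn2l//; lra. Qed.

Lemma open_dball x e : open (dball x e).
Proof.
apply/hopen => y; rewrite /dball /= => xy; exists (e - dist x y); first by lra.
by move=> z yz; have := dist_tri y x z; lra.
Qed.

Let half_ball x O : open O -> O x -> exists n, dball x (3 * half n) `<=` O.
Proof.
move=> /hopen oO /oO[e e0 eO]; have e30 : 0 < e / 3 by lra.
have [n ne] := exp_half_lt e30; exists n => y; rewrite /dball /= => xy.
by apply: eO; lra.
Qed.

(* M. E. Rudin's proof of Stone's theorem. *)
Lemma metric_metacompact (U : set (set X)) : open_cover U ->
  exists V, [/\ open_cover V, point_finite V & refines V U].
Proof.
move=> [oU cU].
have [wo woP] := @well_ordering_principle (set X : eqType).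
have woxx A : wo A A.
  have [|C [[/eqP -> Cmin] _]] := woP (pred1 A); first by exists A; apply: eqxx.
  exact: Cmin (eqxx A).
have wo_anti A B : wo A B -> wo B A -> A = B.
  move=> AB BA; pose P : {pred set X} := pred2 A B.
  have PA : A \in P by rewrite inE eqxx.
  have PB : B \in P by rewrite inE eqxx orbT.
  have [|C [_ Cu]] := woP P; first by exists A.
  have : C = A by apply: Cu; split => // Z; rewrite inE => /orP[]/eqP ->.
  have : C = B by apply: Cu; split => // Z; rewrite inE => /orP[]/eqP ->.
  by move=> ->.
(* The well-ordering assigns to each point the least member of [U] containing it. *)
have /choice[a aP] : forall x, exists A,
    [/\ U A, A x & forall B, U B -> B x -> wo A B].
  move=> x; pose P : {pred set X} := fun A => `[< U A /\ A x >].
  have [|A [[/asboolP[UA Ax] Amin] _]] := woP P.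
    have : (\bigcup_(A in U) A) x by rewrite cU.
    by move=> [A UA Ax]; exists A; apply/asboolP.
  by exists A; split => // B UB Bx; apply: Amin; apply/asboolP.
(* [C n] is the part of the space covered before stage [n] and [D n A] the
   part covered at stage [n] by the member of the refinement assigned to [A]. *)
pose active (C : set X) n x := ~ C x /\ dball x (3 * half n) `<=` a x.
pose C := fix C n : set X := if n is m.+1 then
  C m `|` \bigcup_(x in active (C m) m) dball x (half m) else set0.
pose D n A := \bigcup_(x in [set x | a x = A /\ active (C n) n x])
  dball x (half n).
have C_le m n : (m <= n)%N -> C m `<=` C n.
  move=> /subnK <-; elim: (n - m)%N => [//|k IH] x /IH; rewrite addSn.
  by move=> Cx; left.
have DC n A : D n A `<=` C n.+1 by move=> y [x [_ xn] xy]; right; exists x.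
have CD n y : C n y -> exists m A, U A /\ D m A y.
  elim: n => [//|n IH] [/IH//|[x xn xy]]; exists n, (a x).
  by split; [have [] := aP x | exists x].
have oD n A : open (D n A) by apply: bigcup_open => x _; apply: open_dball.
have DA n A : D n A `<=` A.
  move=> y [x [<- [_ xa]] xy]; apply: xa; rewrite /dball /=.
  by have := half_gt0 n; move: xy; rewrite /dball /=; lra.
exists [set E | exists n A, U A /\ E = D n A]; split.
- split; first by move=> _ [n [A [_ ->]]]; apply: oD.
  apply/seteqP; split=> // x _; have [Ua ax _] := aP x.
  have [n xn] := half_ball (oU _ Ua) ax.
  suff [m [A [UA xA]]] : exists m A, U A /\ D m A x.
    by exists (D m A) => //; exists m, A.
  have [/CD//|nC] := pselect (C n x).
  exists n, (a x); split => //; exists x => //.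
  by rewrite /dball /= distxx half_gt0.
- move=> x; have [Ua ax _] := aP x.
  have [n0 [A0 [_ xA0]]] : exists m A, U A /\ D m A x.
    have [n xn] := half_ball (oU _ Ua) ax.
    have [/CD//|nC] := pselect (C n x).
    exists n, (a x); split => //; exists x => //.
    by rewrite /dball /= distxx half_gt0.
  have [j xj] := half_ball (oD n0 A0) xA0.
  pose slice i := [set E | (exists A, U A /\ E = D i A) /\ E x].
  (* A ball of a stage after [n0 + j] cannot contain [x]: its centre would lie in the ball of radius
     [3 * half j] at [x], hence in the part covered before. *)
  apply: (@sub_finite_set _ _ (\bigcup_(i in `I_(n0 + j).+1) slice i)).
    move=> E [[i [A [UA EE]]] Ex]; exists i; last by split => //; exists A.
    rewrite /= ltnS leqNgt; apply/negP => ij; move: Ex; rewrite EE.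
    move=> [y [_ [nCy _]] yx]; apply: nCy.
    apply: (C_le n0.+1); first by rewrite (leq_ltn_trans _ ij)// leq_addr.
    apply/DC/xj; rewrite /dball /= distC; move: yx; rewrite /dball /=.
    have /half_le : (j <= i)%N by rewrite ltnW// (leq_ltn_trans _ ij)// leq_addl.
    by have := half_gt0 j; lra.
  apply: bigcup_finite => [|i _]; first exact: finite_II.
  have [[E0 sE0]|nE] := pselect (exists E, slice i E); last first.
    apply: (@sub_finite_set _ _ set0) => // E sE; apply: nE; by exists E.
  apply: (@sub_finite_set _ _ [set E0]) => // E sE /=.
  move: sE sE0 => [[A [UA ->]] [p [pA [_ pb]] px]].
  move=> [[B [UB ->]] [q [qB [_ qb]] qx]].
  (* The centres [p], [q] are closer than [3 * half i], so [a p] and [a q] both contain both of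
     them, and minimality gives [a p = a q]. *)
  suff -> : A = B by [].
  have near_pq : dist p q < 3 * half i.
    have := dist_tri x p q; rewrite (distC x q); move: px qx; rewrite /dball /=.
    by have := half_gt0 i; lra.
  have [_ _ pmin] := aP p; have [_ _ qmin] := aP q.
  rewrite -pA -qB; apply: wo_anti.
    apply: pmin; first by rewrite qB.
    by apply: qb; rewrite /dball /= distC near_pq.
  apply: qmin; first by rewrite pA.
  by apply: pb; rewrite /dball /= near_pq.
- by move=> _ [n [A [UA ->]]]; exists A.
Qed.

(** Cutting a cover down to balls of radius [half n] before refining it puts any two points of a
    member of the next cover at distance below [2 * half n]. *)
Lemma metric_development : exists G : nat -> set (set X),
  [/\ forall n, open_cover (G n), forall n, point_finite (G n),
    forall n, refines (G n.+1) (G n) &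
    forall x O, open O -> O x ->
      exists n, forall A, G n A -> A x -> A `<=` O].
Proof.
pose U0 n (V : set (set X)) :=
  [set E | exists A x, V A /\ E = A `&` dball x (half n)].
have U0cover n V : open_cover V -> open_cover (U0 n V).
  move=> [oV cV]; split.
    by move=> _ [A [x [VA ->]]]; apply: openI; [apply: oV|apply: open_dball].
  apply/seteqP; split => // x _; have : (\bigcup_(A in V) A) x by rewrite cV.
  move=> [A VA Ax]; exists (A `&` dball x (half n)); first by exists A, x.
  by split => //; rewrite /dball /= distxx half_gt0.
have /choice[f fP] : forall U : set (set X), exists V, open_cover U ->
    [/\ open_cover V, point_finite V & refines V U].
  move=> U; have [/metric_metacompact[V VP]|nU] := pselect (open_cover U).
    by exists V.
  by exists U.
pose G := fix G n := if n is m.+1 then f (U0 m (G m)) else f [set setT].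
have cG n : open_cover (G n).
  elim: n => [|n IH] /=; last by have [] := fP _ (U0cover n _ IH).
  have [|//] := fP [set setT]; split; first by move=> _ ->; apply: openT.
  by rewrite bigcup_set1.
have GS n := fP _ (U0cover n _ (cG n)).
exists G; split => //.
- case=> [|n]; last by have [] := GS n.
  have [|//] := fP [set setT]; split; first by move=> _ ->; apply: openT.
  by rewrite bigcup_set1.
- move=> n A GA; have [_ _ /(_ A GA)[_ [B [x [GB ->]]] AB]] := GS n.
  by exists B => // y /AB[].
- move=> x O oO Ox; have [n nO] := half_ball oO Ox; exists n.+1 => A GA Ax.
  have [_ _ /(_ A GA)[_ [B [z [GB ->]]] AB]] := GS n.
  move=> y Ay; apply: nO; have [_ zx] := AB x Ax; have [_ zy] := AB y Ay.
  rewrite /dball /=; have := dist_tri z x y; rewrite (distC x z).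
  by move: zx zy; rewrite /dball /=; have := half_gt0 n; lra.
Qed.

End MetricMetacompact.

(** * A monotone refinement operator from a development *)

Section Development.
Context {X : topologicalType}.

Lemma development_monotonically_metacompact (G : nat -> set (set X)) :
  (forall n, open_cover (G n)) -> (forall n, point_finite (G n)) ->
  (forall n, refines (G n.+1) (G n)) ->
  (forall x O, open O -> O x ->
    exists n, forall A, G n A -> A x -> A `<=` O) ->
  monotonically_metacompact X.
Proof.
move=> cG fG rG dG.
have rG' m n : (n <= m)%N -> refines (G m) (G n).
  move=> /subnK <-; elim: (m - n)%N => [|k IH] A; first by exists A.
  rewrite addSn => /rG[B /IH[C GC BC] AB]; exists C => //.
  exact: subset_trans BC.
pose inside (U : set (set X)) A := exists2 B, U B & A `<=` B.
have insideS U A B : A `<=` B -> inside U B -> inside U A.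
  by move=> AB [C UC BC]; exists C => //; apply: subset_trans BC.
pose r U := [set A | exists n, [/\ G n A, inside U A &
  forall k B, (k < n)%N -> G k B -> A `<=` B -> ~ inside U B]].
(* A member inside [U] that contains [A] and has the least possible level belongs to [r U]. Covering
   and monotonicity both follow from this. *)
have rP U n A : G n A -> inside U A -> exists2 B, r U B & A `<=` B.
  move=> GA UA; pose P k := `[< exists B, [/\ G k B, inside U B & A `<=` B] >].
  have exP : exists k, P k by exists n; apply/asboolP; exists A; split.
  case: (ex_minnP exP) => k /asboolP[B [GB UB AB]] kmin; exists B => //.
  exists k; split => // j C jk GC BC UC.
  suff /kmin : P j by rewrite leqNgt jk.
  by apply/asboolP; exists C; split => //; apply: subset_trans BC.
exists r; split => [U [oU cU]|U V _ _ UV A [n [GA [B UB AB] _]]]; last first.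
  have [C VC BC] := UV B UB.
  by apply: (rP V n A GA); exists C => //; apply: subset_trans BC.
split; last by move=> A [n [_ [B UB AB] _]]; exists B.
- split; first by move=> A [n [/(cG n).1]].
  apply/seteqP; split => // x _.
  have : (\bigcup_(A in U) A) x by rewrite cU.
  move=> [O UO Ox]; have [n nO] := dG x O (oU O UO) Ox.
  have : (\bigcup_(A in G n) A) x by rewrite (cG n).2.
  move=> [A GA Ax].
  have [|B rB AB] := rP U n A GA; first by exists O => //; apply: nO.
  by exists B => //; apply: AB.
- move=> x; have : (\bigcup_(A in U) A) x by rewrite cU.
  move=> [O UO Ox]; have [n nO] := dG x O (oU O UO) Ox.
  (* A member of [r U] at [x] has level at most [n]: one of higher level would be contained in a
     member of [G n] at [x], which is inside [O]. *)
  apply: (@sub_finite_set _ _ (\bigcup_(k in `I_n.+1) [set A | G k A /\ A x])).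
    move=> A [[m [GA _ Amin]] Ax]; exists m => //=; rewrite ltnS leqNgt.
    apply/negP => nm; have [B GB AB] := rG' m n (ltnW nm) A GA.
    apply: (Amin n B nm GB AB); exists O => //.
    by apply: nO => //; apply: AB.
  by apply: bigcup_finite => // k _; apply: fG.
Qed.

End Development.

Lemma metrizable_monotonically_metacompact (R : realType) (X : topologicalType) :
  metrizable R X -> monotonically_metacompact X.
Proof.
move=> /metrizableP[dist hd hopen].
have [G [cG fG rG dG]] := metric_development hd hopen.
exact: development_monotonically_metacompact dG.
Qed.

(* The order dual keeps the topology, so that statements about left rays are
   those about right rays in [X^d]. *)
HB.instance Definition _ d (X : POrderedTopological.type d) :=
  Topological.copy (X^d)%type (X : topologicalType).

(** * Closed-discrete and sigma-closed-discrete sets *)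

Section ClosedDiscrete.
Context {X : topologicalType}.
Implicit Types F S : set X.

Lemma closed_discreteS F S : S `<=` F -> closed_discrete F -> closed_discrete S.
Proof.
move=> SF cF x; have [N xN N1] := cF x; exists N => // y z [Ny Sy] [Nz Sz].
by apply: N1; split => //; apply: SF.
Qed.

(** The one point of [F] that [N] may contain is cut off by the T1 property if it is not [x]. *)
Lemma closed_discrete_nbhs F (x : X) : hausdorff_space X -> closed_discrete F ->
  exists2 N : set X, nbhs x N & forall y, N y -> F y -> y = x.
Proof.
move=> /hausdorff_accessible aX cF; have [N xN N1] := cF x.
have [[y [Ny Fy yx]]|nF] := pselect (exists y, [/\ N y, F y & y <> x]).
  have /aX[A [oA Ax Ay]] : x != y by apply/eqP => xy; apply: yx.
  exists (N `&` A).
    by apply: filterI => //; apply: open_nbhs_nbhs; split => //; rewrite -inE.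
  move=> z [Nz Az] Fz; have zy : z = y by apply: N1.
  by move: Ay; rewrite inE /= -zy.
exists N => // y Ny Fy; apply: contrapT => yx.
by apply: nF; exists y.
Qed.

Lemma finite_closed_discrete F : hausdorff_space X ->
  (forall x : X, exists2 N : set X, nbhs x N & finite_set (N `&` F)) ->
  closed_discrete F.
Proof.
move=> hX fF x; have [N xN finN] := fF x.
exists (N `&` ~` ((N `&` F) `\ x)).
  apply: filterI => //; apply: open_nbhs_nbhs; split.
    apply: closed_openC.
    apply: (accessible_finite_set_closed.1 (hausdorff_accessible hX)).
    exact: finite_setD.
  by case=> _; apply.
suff xP y : (N `&` ~` ((N `&` F) `\ x) `&` F) y -> y = x.
  by move=> y z /xP -> /xP ->.
move=> [[Ny nFy] Fy]; apply: contrapT => yx; apply: nFy.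
by split.
Qed.

Lemma closed_discreteU F S : hausdorff_space X ->
  closed_discrete F -> closed_discrete S -> closed_discrete (F `|` S).
Proof.
move=> hX cF cS x; have [N xN NF] := closed_discrete_nbhs x hX cF.
have [M xM MS] := closed_discrete_nbhs x hX cS.
exists (N `&` M); first exact: filterI.
suff xP y : ((N `&` M) `&` (F `|` S)) y -> y = x.
  by move=> y z /xP -> /xP ->.
by move=> [[Ny My] [Fy|Sy]]; [apply: NF|apply: MS].
Qed.

Lemma closed_discrete0 : closed_discrete (set0 : set X).
Proof. by move=> x; exists setT; [apply: filterT|move=> y z []]. Qed.

Lemma sigma_closed_discreteS F S :
  S `<=` F -> sigma_closed_discrete F -> sigma_closed_discrete S.
Proof.
move=> SF [K cK FE]; exists (fun n => K n `&` S).
  by move=> n; apply: closed_discreteS (cK n) => x [].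
rewrite -setI_bigcupl -FE; apply/seteqP; split=> [x Sx|x []//].
by split => //; apply: SF.
Qed.

Lemma sigma_closed_discreteU F S : hausdorff_space X ->
  sigma_closed_discrete F -> sigma_closed_discrete S ->
  sigma_closed_discrete (F `|` S).
Proof.
move=> hX [K cK ->] [M cM ->]; exists (fun n => K n `|` M n).
  by move=> n; apply: closed_discreteU.
by rewrite bigcupU.
Qed.

Lemma sigma_closed_discrete_bigcup (S : nat -> set X) :
  (forall n, sigma_closed_discrete (S n)) ->
  sigma_closed_discrete (\bigcup_n S n).
Proof.
move=> sS; have /choice[K KP] : forall n, exists K : nat -> set X,
    (forall k, closed_discrete (K k)) /\ S n = \bigcup_k K k.
  by move=> n; have [K cK SK] := sS n; exists K.
exists (fun i => if @unpickle (nat * nat)%type i is Some (n, k) then K n k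
                 else set0).
  move=> i; case: unpickle => [[n k]|]; last exact: closed_discrete0.
  exact: (KP n).1.
apply/seteqP; split=> x [n _].
  rewrite (KP n).2 => -[k _ Kx]; exists (pickle (n, k)) => //.
  by rewrite pickleK.
case: unpickle => [[m k] Kx|//]; exists m => //.
by rewrite (KP m).2; exists k.
Qed.

Lemma sigma_closed_discrete_nondecreasing F : hausdorff_space X ->
  sigma_closed_discrete F -> exists K : nat -> set X,
  [/\ forall n, closed_discrete (K n), forall n, K n `<=` K n.+1 &
    F = \bigcup_n K n].
Proof.
move=> hX [K cK ->].
pose M := fix M n : set X := if n is m.+1 then M m `|` K n else K 0%N.
exists M; split.
- by elim=> [|n IH] /=; [apply: cK|apply: closed_discreteU].
- by move=> n x Mx; left.
- apply/seteqP; split=> x [n _ Kx].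
    by exists n => //; case: n Kx => [//|n Kx]; right.
  elim: n Kx => [K0|n IH /= [/IH//|Kx]]; first by exists 0%N.
  by exists n.+1.
Qed.

End ClosedDiscrete.

Lemma is_subset1_finite (T : Type) (A : set T) : is_subset1 A -> finite_set A.
Proof.
move=> A1; have [[x Ax]|nA] := pselect (exists x, A x).
  by apply: (@sub_finite_set _ _ [set x]) => // y Ay /=; apply: A1.
by apply: (@sub_finite_set _ _ set0) => // y Ay; apply: nA; exists y.
Qed.

(** * Rays and closed-discrete sets in GO-spaces *)

Section GOSpaces.
Local Open Scope order_scope.
Context {d : Order.disp_t} {X : POrderedTopological.type d}.
Hypothesis hGO : GO_space X.
Implicit Types (x y z : X) (F S : set X).

Definition right_open : set X := [set x | open [set y | x <= y]].
Definition left_open : set X := [set x | open [set y | y <= x]].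

Lemma GO_hausdorff : hausdorff_space X. Proof. by case: hGO. Qed.

Lemma GO_leVlt x y : x <= y \/ y < x.
Proof.
have [tot _ _] := hGO; have /orP[xy|yx] := tot x y; first by left.
by have [->|ne] := eqVneq x y; [left|right; rewrite lt_neqAle eq_sym ne].
Qed.

Lemma GO_convex_nbhs x N : nbhs x N ->
  exists C, [/\ open C, C x, order_convex C & C `<=` N].
Proof.
have [_ _ [B [oB bB] cB]] := hGO => /(bB x)[C [BC Cx] CN].
by exists C; split => //; [apply: oB|apply: cB].
Qed.

(** A convex neighbourhood of [y < x] that misses [x] cannot extend past [x]. *)
Lemma GO_open_lt x : open [set y | y < x].
Proof.
rewrite openE => y yx; have /hausdorff_accessible aX := GO_hausdorff.
have /aX[A [oA Ay Ax]] : y != x by rewrite lt_eqF.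
have [|C [oC Cy cC CA]] := @GO_convex_nbhs y A.
  by apply: open_nbhs_nbhs; split => //; rewrite -inE.
apply: (@filterS _ _ _ C); last exact: open_nbhs_nbhs.
move=> z Cz /=; have [xz|//] := GO_leVlt x z.
move: Ax; rewrite inE; case; apply: CA; apply: (cC y z) => //.
by rewrite ltW.
Qed.

End GOSpaces.

Lemma GO_dual d (X : POrderedTopological.type d) :
  GO_space X -> GO_space (X^d)%type.
Proof.
case=> tot hX [B bB cB]; split=> [x y||]; [exact: tot y x|exact: hX|].
exists B => // C BC x y z Cx Cy /andP[zx yz].
by apply: (cB C BC y x) => //; apply/andP; split.
Qed.

Section Separated.
Local Open Scope order_scope.
Context {d : Order.disp_t} {X : POrderedTopological.type d}.
Hypothesis hGO : GO_space X.
Implicit Types (x y z : X) (F S : set X).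

Lemma GO_open_gt x : open [set y | x < y].
Proof. exact: (GO_open_lt (GO_dual hGO) x). Qed.

Lemma closed_discrete_convex F x : closed_discrete F ->
  exists C, [/\ open C, C x, order_convex C & forall y, C y -> F y -> y = x].
Proof.
move=> /(closed_discrete_nbhs x (GO_hausdorff hGO))[N xN NF].
have [C [oC Cx cC CN]] := GO_convex_nbhs hGO xN.
by exists C; split => // y /CN; apply: NF.
Qed.

(** In a convex neighbourhood of [x] meeting [F] at most in [x], the point of [F] between two points
    of [S] has to be [x]. So each side of [x] holds at most one point of [S] there. *)
Lemma separated_closed_discrete F S : closed_discrete F ->
  (forall x y, S x -> S y -> x < y -> exists2 p, F p & x <= p <= y) ->
  closed_discrete S.
Proof.
move=> cF FS; apply: finite_closed_discrete (GO_hausdorff hGO) _ => x.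
have [C [oC Cx cC CF]] := closed_discrete_convex x cF.
have CS y z : C y -> S y -> C z -> S z -> y < z -> y <= x <= z.
  move=> Cy Sy Cz Sz yz; have [p Fp ypz] := FS y z Sy Sz yz.
  by rewrite -(CF p) //; apply: (cC y z).
exists C; first exact: open_nbhs_nbhs.
have CS1 (P : set X) : (forall y, P y -> x < y) \/ (forall y, P y -> y < x) ->
    finite_set (C `&` S `&` P).
  move=> Px; apply: is_subset1_finite => y z [[Cy Sy] Py] [[Cz Sz] Pz].
  have no u v : C u -> S u -> P u -> C v -> S v -> P v -> ~ u < v.
    move=> Cu Su Pu Cv Sv Pv /(CS _ _ Cu Su Cv Sv) /andP[ux xv].
    by case: Px => [/(_ u Pu)|/(_ v Pv)] /lt_geF; rewrite ?ux ?xv.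
  have [yz|/no//] := GO_leVlt hGO y z; last by move/(_ Cz Sz Pz Cy Sy Py).
  by move: yz; rewrite le_eqVlt => /orP[/eqP//|/no]; case.
apply: (@sub_finite_set _ _ ([set x] `|`
  (C `&` S `&` [set y | x < y]) `|` (C `&` S `&` [set y | y < x]))).
  move=> y [Cy Sy]; have [|yx] := GO_leVlt hGO x y; last by right.
  by rewrite le_eqVlt => /orP[/eqP ->|xy]; left; [left|right].
rewrite !finite_setU; split; first split => //.
  by apply: CS1; left.
by apply: CS1; right.
Qed.

End Separated.

(** * Sigma-closed-discreteness of the points with open right ray *)

Section RightOpen.
Local Open Scope order_scope.
Context {d : Order.disp_t} {X : POrderedTopological.type d}.
Hypothesis hGO : GO_space X.
Implicit Types (x y z : X) (F S D : set X).

Definition cut_cover x : set (set X) :=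
  [set A | A = [set y | y < x] \/ A = [set y | x <= y]].

Lemma cut_cover_open_cover x : right_open x -> open_cover (cut_cover x).
Proof.
move=> Rx; split; first by move=> A [] -> //; apply: GO_open_lt.
apply/seteqP; split=> // y _; have [xy|yx] := GO_leVlt hGO x y.
  by exists [set y | x <= y] => //; right.
by exists [set y | y < x] => //; left.
Qed.

Lemma countable_cut_cover x : countable (cut_cover x).
Proof.
apply: (@sub_countable _ _ _ ([set [set y | y < x]] `|` [set [set y | x <= y]])).
  by apply: subset_card_le => A [] ->; [left|right].
by apply: finite_set_countable; rewrite finite_setU; split.
Qed.

Section Refinement.
Variables (r : set (set X) -> set (set X)) (V : X -> set X).
Hypothesis hr : monotone_point_finite_refinement
  [set U : set (set X) | open_cover U /\ countable U] r.
Hypothesis hV : forall x, right_open x -> r (cut_cover x) (V x) /\ V x x.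

(* The countable cover by [(<-, s 0)] and the rays [[s n, ->)] is refined by
   every [cut_cover (s n)]; so each [V (s n)] lies in one of the finitely many
   members of its refinement that contain [p], yet each such member is bounded
   below by some [s m]. *)
Lemma no_decreasing_sequence (p : X) (s : nat -> X) :
  (forall n, right_open (s n)) -> s 0%N <= p -> (forall n, V (s n) p) ->
  ~ forall n, s n.+1 < s n.
Proof.
move=> sR sp sV sdecr.
have santi m n : (m < n)%N -> s n < s m.
  elim: n => [//|n IH]; rewrite ltnS leq_eqVlt => /orP[/eqP->//|/IH].
  exact: lt_trans.
pose ray n := if n is m.+1 then [set y | s m <= y] else [set y | y < s 0%N].
pose U : set (set X) := range ray.
have KU : open_cover U /\ countable U.
  split; last by apply: sub_countable (card_image_le _ _) _.
  split; first by move=> A [[|n] _ <-]; [apply: GO_open_lt|apply: sR].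
  apply/seteqP; split=> // y _; have [sy|ys] := GO_leVlt hGO (s 0%N) y.
    by exists [set y | s 0%N <= y] => //; exists 1%N.
  by exists [set y | y < s 0%N] => //; exists 0%N.
have cutU n : refines (cut_cover (s n)) U.
  move=> A [] ->; last by exists [set y | s n <= y] => //; exists n.+1.
  exists [set y | y < s 0%N]; first by exists 0%N.
  move=> y /= /lt_le_trans; apply; case: n => [//|n].
  exact/ltW/santi.
have [hr1 hr2] := hr; have [_ fU rU] := hr1 U KU.
have /choice[W WP] : forall n, exists W, r U W /\ V (s n) `<=` W.
  move=> n; have Kn : open_cover (cut_cover (s n)) /\ countable (cut_cover (s n)).
    by split; [apply: cut_cover_open_cover|apply: countable_cut_cover].
  have [W UW VW] := hr2 _ _ Kn KU (cutU n) _ (hV (sR n)).1.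
  by exists W.
have /choice[b bP] : forall A, exists m, r U A -> A p ->
    A `<=` [set y | s m <= y].
  move=> A; have [[UA Ap]|nA] := pselect (r U A /\ A p); last first.
    by exists 0%N => ? ?; case: nA.
  have [B [[|m] _ <-] AB] := rU A UA; last by exists m.
  by have : p < s 0%N := AB _ Ap; rewrite le_gtF.
have /finite_seqP[fA fAE] := fU p.
have Wf n : W n \in fA.
  have [UW VW] := WP n.
  suff : [set A | r U A /\ A p] (W n) by rewrite fAE.
  by split => //; apply: VW.
(* Every member through [p] is bounded below by some [s m] with [m <= M], but the one containing
   [V (s M.+1)] contains [s M.+1]. *)
pose M := (\max_(A <- fA) b A)%N.
have bM n : (b (W n) <= M)%N by apply: leq_bigmax_seq.
have [UW VW] := WP M.+1.
have := bP _ UW (VW _ (sV _)) _ (VW _ (hV (sR M.+1)).2).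
by rewrite /= lt_geF//; apply: santi; rewrite ltnS.
Qed.

Lemma exists_least (A : set X) : A !=set0 ->
  (forall s : nat -> X, (forall n, A (s n)) -> ~ forall n, s n.+1 < s n) ->
  exists2 x, A x & forall y, A y -> x <= y.
Proof.
move=> [x0 Ax0] nA; apply: contrapT => nmin.
have /choice[f fP] : forall x, exists y, A x -> A y /\ y < x.
  move=> x; have [Ax|] := pselect (A x); last by exists x.
  apply: contrapT => nx; apply: nmin; exists x => // y Ay.
  have [//|yx] := GO_leVlt hGO x y.
  by case: nx; exists y.
have As n : A (iter n f x0) by elim: n => // n /fP[].
by apply: (nA (fun n => iter n f x0)) => // n; have [] := fP _ (As n).
Qed.

(** All [V a] with [a] in [S] and in [(x, y]] contain [y], so [no_decreasing_sequence] provides a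
    least such [a]. *)
Lemma least_above S x y : x < y -> S y -> S `<=` right_open ->
  (forall a, S a -> x < a -> a <= y -> V a y) ->
  exists2 z, x < z & forall a, S a -> x < a -> z <= a.
Proof.
move=> xy Sy SR SV.
have [|s sA|z [Sz [xz zy]] zmin] :=
    @exists_least [set a | S a /\ (x < a /\ a <= y)].
- by exists y.
- apply: (@no_decreasing_sequence y s) => [n||n].
  + by have [/SR] := sA n.
  + by have [_ []] := sA 0%N.
  + by have [? []] := sA n; apply: SV.
- exists z => // a Sa xa; have [ay|ya] := GO_leVlt hGO a y.
    exact: zmin.
  by rewrite (le_trans zy)// ltW.
Qed.

(** Points of [D] are set aside because outside [D] a point with open right ray is a limit from the
    right, which leaves room for a point of [D] in the gap above it. *)
Definition reaching F D : set X := [set x | [/\ right_open x, ~ D x &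
  exists p, [/\ F p, x <= p & forall z, x <= z -> z <= p -> V x z]]].

Lemma right_open_above D x C : dense D -> right_open x -> ~ D x -> open C ->
  C x -> exists2 y, x < y & C y.
Proof.
move=> dD Rx Dx oC Cx; apply: contrapT => nC; apply: Dx.
have [] := dD (C `&` [set y | x <= y]).
- by exists x; split => //=.
- exact: openI.
move=> y [[Cy /= xy] Dy]; suff -> : x = y by [].
apply/eqP; move: xy; rewrite le_eqVlt => /orP[//|xy].
by case: nC; exists y.
Qed.

(* Take an order-convex neighbourhood of [x] missing [F] except at [x]. Every
   point [a] of [reaching F D] in it to the right of [x] has [V a] running past
   that neighbourhood, so such points cannot decrease to [x]. *)
Lemma reaching_gap F D x : closed_discrete F -> dense D -> reaching F D x ->
  exists2 z, x < z & forall a, reaching F D a -> x < a -> z <= a.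
Proof.
move=> cF dD [Rx Dx _].
have [C [oC Cx cC CF]] := closed_discrete_convex hGO x cF.
have [[y [xy Cy Sy]]|nS] :=
    pselect (exists y, [/\ x < y, C y & reaching F D y]); last first.
  have [y xy Cy] := right_open_above dD Rx Dx oC Cx.
  exists y => // a Sa xa; have [//|ay] := GO_leVlt hGO y a.
  case: nS; exists a; split => //; apply: (cC x y) => //.
  by rewrite !ltW.
apply: (least_above xy Sy) => [a []//|a [Ra Da [p [Fp ap pV]]] xa ay].
apply: pV => //; have [//|py] := GO_leVlt hGO y p.
have Cp : C p by apply: (cC x y) => //; rewrite (ltW py) (le_trans (ltW xa)).
by move: ap; rewrite (CF p Cp Fp) lt_geF.
Qed.

Lemma reaching_sigma_closed_discrete F D : closed_discrete F -> dense D ->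
  sigma_closed_discrete D -> sigma_closed_discrete (reaching F D).
Proof.
move=> cF dD [K cK DE].
have /choice[t tP] : forall x, exists t, reaching F D x ->
    [/\ D t, x < t & forall a, reaching F D a -> x < a -> t < a].
  move=> x; have [Sx|] := pselect (reaching F D x); last by exists x.
  have [z xz zmin] := reaching_gap cF dD Sx.
  have [Rx Dx _] := Sx.
  (* The open interval from [x] to [z] is not empty, so it contains a point of [D]. *)
  have [|y xy yz] := right_open_above dD Rx Dx (GO_open_lt hGO z).
    exact: xz.
  have [||t [/= [xt tz] Dt]] := dD ([set u | x < u] `&` [set u | u < z]).
  - by exists y.
  - by apply: openI; [apply: GO_open_gt|apply: GO_open_lt].
  exists t => _; split => // a Sa xa; apply: lt_le_trans tz _.
  exact: zmin.
(* The points are sorted by a [K n] containing [t x], and [t x] separates [x] from all later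
   points. *)
exists (fun n => reaching F D `&` [set x | K n (t x)]).
  move=> n; apply: (separated_closed_discrete hGO (cK n)).
  move=> x y [Sx Kx] [Sy _] xy; exists (t x) => //.
  by have [_ xt /(_ y Sy xy) ty] := tP x Sx; rewrite !ltW.
rewrite -setI_bigcupr; apply/seteqP; split=> [x Sx|x []//]; split=> //.
have [Dt _ _] := tP x Sx; move: Dt; rewrite DE => -[n _ Kn].
by exists n.
Qed.

End Refinement.

Lemma right_open_sigma_closed_discrete D :
  monotonically_countably_metacompact X -> dense D ->
  sigma_closed_discrete D -> sigma_closed_discrete (right_open : set X).
Proof.
move=> [r hr] dD sD; have [K cK DE] := sD.
have /choice[V VP] : forall x, exists V, right_open x ->
    r (cut_cover x) V /\ V x.
  move=> x; have [Rx|] := pselect (right_open x); last by exists setT.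
  have [|[_ cr] _ _] := hr.1 (cut_cover x).
    by split; [apply: cut_cover_open_cover|apply: countable_cut_cover].
  have : (\bigcup_(A in r (cut_cover x)) A) x by rewrite cr.
  by move=> [A rA Ax]; exists A.
(* By density, a convex part of [V x] around [x] contains a point [p >= x] of some [K n]; so [x]
   reaches [K n]. *)
apply: (@sigma_closed_discreteS _ (D `|` \bigcup_n reaching V (K n) D)).
  move=> x Rx; have [Dx|Dx] := pselect (D x); [by left|right].
  have [rV Vx] := VP x Rx.
  have [|[oV _] _ _] := hr.1 (cut_cover x).
    by split; [apply: cut_cover_open_cover|apply: countable_cut_cover].
  have [|C [oC Cx cC CV]] := @GO_convex_nbhs _ _ hGO x (V x).
    by apply: open_nbhs_nbhs; split => //; apply: oV.
  have [||p [[Cp /= xp] Dp]] := dD (C `&` [set y | x <= y]).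
  - by exists x; split => //=.
  - exact: openI.
  have [n _ Kp] : (\bigcup_n K n) p by rewrite -DE.
  exists n => //; split => //.
  exists p; split => // z xz zp; apply: CV; apply: (cC x p) => //.
  by rewrite xz.
apply: sigma_closed_discreteU => //; first exact: GO_hausdorff.
apply: sigma_closed_discrete_bigcup => n.
exact: (reaching_sigma_closed_discrete hr VP).
Qed.

End RightOpen.

(** * Closeness relations and metrizability of the GO-space *)

Section Entourages.
Local Open Scope order_scope.

(** If [x] is in [Rn n], no [y < x] qualifies. Otherwise [D] has points [p < q < x] with [p] in [C];
    once both are in [G n], any [y < p] has two points of [G n] between itself and [x]. The order is
    a parameter, so that [X^d] gives the right half of a ball. *)
Lemma left_ball d (X : POrderedTopological.type d) (D C : set X)
    (G Rn : nat -> set X) (x : X) :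
  GO_space X -> dense D -> D `<=` \bigcup_n G n ->
  (forall n, G n `<=` G n.+1) -> right_open `<=` \bigcup_n Rn n ->
  open C -> order_convex C -> C x ->
  exists n, forall y, y <= x ->
    (forall p q, G n p -> G n q -> y <= p -> p <= x -> y <= q -> q <= x ->
      p = q) ->
    (forall p, Rn n p -> y < p -> p <= x -> False) -> C y.
Proof.
move=> hGO dD DG Gmono RE oC cC Cx.
have Gle m n : (m <= n)%N -> G m `<=` G n.
  move=> /subnK <-; elim: (n - m)%N => [//|k IH] y /IH; rewrite addSn.
  exact: Gmono.
have [/RE[n _ Rx]|nRx] := pselect (right_open x).
  exists n => y; rewrite le_eqVlt => /orP[/eqP -> //|yx] _ /(_ x Rx yx).
  by case.
(* If [E] had no points below [x], then [[x, ->)] would be the union of [E] and [(x, ->)], thus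
   open. *)
have below E : open E -> E x -> exists2 p, p < x & E p /\ D p.
  move=> oE Ex; have [||p [[/= Ep px] Dp]] := dD (E `&` [set y | y < x]).
  - apply: contrapT => nE; apply: nRx; rewrite /right_open /=.
    suff -> : [set y | x <= y] = E `|` [set y | x < y].
      by apply: openU => //; apply: GO_open_gt.
    apply/seteqP; split=> y /=.
      by rewrite le_eqVlt => /orP[/eqP <-|xy]; [left|right].
    move=> [Ey|]; last exact: ltW.
    have [//|yx] := GO_leVlt hGO x y.
    by case: nE; exists y.
  - by apply: openI => //; apply: GO_open_lt.
  by exists p.
have [p px [Cp Dp]] := below C oC Cx.
have [|//|q qx [/= pq Dq]] := below [set y | p < y]; first exact: GO_open_gt.
have [[i _ Gp] [j _ Gq]] := (DG p Dp, DG q Dq).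
exists (maxn i j) => y yx y1 _; have [py|yp] := GO_leVlt hGO p y.
  by apply: (cC p x) => //; rewrite py.
have pqE : p = q.
  apply: y1; rewrite ?(ltW px) ?(ltW qx) ?(ltW yp) ?(ltW (lt_trans yp pq))//.
    exact: Gle (leq_maxl i j) _ Gp.
  exact: Gle (leq_maxr i j) _ Gq.
by move: pq; rewrite pqE ltxx.
Qed.

Context {R : realType} {d : Order.disp_t} {X : POrderedTopological.type d}.
Hypothesis hGO : GO_space X.
Implicit Types (x y z : X) (F S D : set X).

Definition midpoints (c : X -> X -> X) F : set X :=
  [set z | exists p q, [/\ F p, F q, exists y, p < y /\ y < q,
    forall g, F g -> p < g -> g < q -> False & z = c p q]].

(** Gaps between neighbouring points of [F] are equal or disjoint, so a point of [F] lies between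
    any two distinct inserted points. *)
Lemma closed_discrete_midpoints (c : X -> X -> X) F :
  (forall p q, (exists y, p < y /\ y < q) -> p < c p q /\ c p q < q) ->
  closed_discrete F -> closed_discrete (midpoints c F).
Proof.
move=> cP cF; apply: (separated_closed_discrete hGO cF).
move=> _ _ [p [q [Fp Fq pq gap ->]]] [p' [q' [Fp' Fq' pq' gap' ->]]] lt_cc'.
have [[pc cq] [pc' cq']] := (cP _ _ pq, cP _ _ pq').
have [qc'|c'q] := GO_leVlt hGO q (c p' q').
  by exists q => //; rewrite ltW.
have p'q : p' < q := lt_trans pc' c'q.
have pq'' : p < q' by rewrite (lt_trans pc)// (lt_trans lt_cc').
have le_p : p' <= p by have [//|/(gap _ Fp')] := GO_leVlt hGO p' p; case.
have le_q : q <= q' by have [//|/(gap _ Fq')] := GO_leVlt hGO q q'; case.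
have ge_p : p <= p'.
  have [//|/(gap' _ Fp)] := GO_leVlt hGO p p'; case.
  by rewrite (lt_le_trans _ le_q)// (lt_trans pc).
have ge_q : q' <= q by have [//|/(gap' _ Fq p'q)] := GO_leVlt hGO q' q; case.
have pE : p = p' by apply/le_anti/andP.
have qE : q = q' by apply/le_anti/andP.
by move: lt_cc'; rewrite pE qE ltxx.
Qed.

Section Relation.
Variables (G Rn Ln : nat -> set X).
Hypothesis cG : forall n, closed_discrete (G n).
Hypothesis cR : forall n, closed_discrete (Rn n).
Hypothesis cL : forall n, closed_discrete (Ln n).
Hypothesis GS : forall n, G n `<=` G n.+1.
Hypothesis RS : forall n, Rn n `<=` Rn n.+1.
Hypothesis LS : forall n, Ln n `<=` Ln n.+1.
Hypothesis RE : right_open = \bigcup_n Rn n.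
Hypothesis LE : left_open = \bigcup_n Ln n.
Hypothesis Gmid : forall n p y q, G n p -> G n q -> p < y -> y < q ->
  exists c, [/\ G n.+1 c, p < c & c < q].

(* [x] and [y] are [n]-close when the interval between them contains at most
   one point of [G n] and crosses no clopen cut at [Rn n] or [Ln n]. *)
Definition close_le n x y : Prop := [/\ x <= y,
  forall p q, G n p -> G n q -> x <= p -> p <= y -> x <= q -> q <= y -> p = q,
  forall p, Rn n p -> x < p -> p <= y -> False &
  forall p, Ln n p -> x <= p -> p < y -> False].

Definition closeness n x y : Prop := close_le n x y \/ close_le n y x.

Lemma closeness_refl n x : closeness n x x.
Proof.
left; split => // [p q _ _ xp px xq qx|p _ xp px|p _ xp px].
- by rewrite -(@le_anti _ _ x p) ?xp// -(@le_anti _ _ x q) ?xq.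
- by move: xp; rewrite le_gtF.
- by move: px; rewrite le_gtF.
Qed.

Lemma closeness_sym n x y : closeness n x y -> closeness n y x.
Proof. by case; [right|left]. Qed.

Lemma closeness_le n x y : x <= y -> closeness n x y -> close_le n x y.
Proof.
move=> xy [//|yxn]; have [yx _ _ _] := yxn.
by move: yxn; rewrite (@le_anti _ _ x y) ?xy.
Qed.

Lemma close_leS n x y : close_le n.+1 x y -> close_le n x y.
Proof.
move=> [xy Gxy Rxy Lxy]; split => // [p q /GS Gp /GS Gq|p /RS|p /LS].
- exact: Gxy.
- exact: Rxy.
- exact: Lxy.
Qed.

Lemma close_le_sub n x y x' y' : x <= x' -> x' <= y' -> y' <= y ->
  close_le n x y -> close_le n x' y'.
Proof.
move=> xx' xy' yy' [_ Gxy Rxy Lxy]; split => //.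
- move=> p q Gp Gq xp py xq qy.
  apply: Gxy => //; [exact: le_trans xp|exact: le_trans yy'|
    exact: le_trans xq|exact: le_trans yy'].
- move=> p Rp xp py; apply: (Rxy p Rp).
    exact: le_lt_trans xp.
  exact: le_trans yy'.
- move=> p Lp xp py; apply: (Lxy p Lp).
    exact: le_trans xp.
  exact: lt_le_trans yy'.
Qed.

(* If [p < y < q] with [p], [q] in [G n], then some point of [G n.+1] lies
   between them, on the same side of [y] as one of them. *)
Lemma close_le_trans n x y z :
  close_le n.+1 x y -> close_le n.+1 y z -> close_le n x z.
Proof.
move=> xy yz; have [lxy _ Rxy Lxy] := close_leS xy.
have [lyz _ Ryz Lyz] := close_leS yz.
have [[_ Gxy _ _] [_ Gyz _ _]] := (xy, yz).
split; first exact: le_trans lyz.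
- have no p q : G n p -> G n q -> x <= p -> q <= z -> p < q -> False.
    move=> Gp Gq xp qz pq.
    have ne (u v : X) : u < v -> u = v -> False by move=> uv E; rewrite E ltxx in uv.
    have [yp|py] := GO_leVlt hGO y p.
      apply: (ne _ _ pq); apply: Gyz => //; try exact: GS.
      + by rewrite (le_trans _ qz)// ltW.
      + by rewrite (le_trans yp)// ltW.
    have [qy|yq] := GO_leVlt hGO q y.
      apply: (ne _ _ pq); apply: Gxy => //; try exact: GS.
      + exact: ltW.
      + by rewrite (le_trans xp)// ltW.
    have [c [Gc pc cq]] := Gmid Gp Gq py yq.
    have [cy|yc] := GO_leVlt hGO c y.
      apply: (ne _ _ pc); apply: Gxy => //; try exact: GS.
      + exact: ltW.
      + by rewrite (le_trans xp)// ltW.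
    apply: (ne _ _ cq); apply: Gyz => //; try exact: GS.
    + exact: ltW.
    + by rewrite (le_trans _ qz)// ltW.
    + exact: ltW.
  move=> p q Gp Gq xp pz xq qz.
  have [|/(no q p Gq Gp xq pz)//] := GO_leVlt hGO p q.
  by rewrite le_eqVlt => /orP[/eqP//|/(no p q Gp Gq xp qz)].
- move=> p Rp xp pz; have [py|yp] := GO_leVlt hGO p y; first exact: (Rxy p).
  exact: (Ryz p).
- move=> p Lp xp pz; have [yp|py] := GO_leVlt hGO y p; first exact: (Lyz p).
  exact: (Lxy p).
Qed.

(** By symmetry let [u <= w]. If [v] is outside the interval from [u] to [w], this interval is part
    of a close one; otherwise [close_le_trans] applies. *)
Lemma closeness_trans n x y z :
  closeness n.+1 x y -> closeness n.+1 y z -> closeness n x z.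
Proof.
have main u v w : u <= w -> closeness n.+1 u v -> closeness n.+1 v w ->
    closeness n u w.
  move=> uw uv vw; left; have [uv'|vu] := GO_leVlt hGO u v.
    have [vw'|wv] := GO_leVlt hGO v w.
      exact: close_le_trans (closeness_le uv' uv) (closeness_le vw' vw).
    apply/close_leS/(close_le_sub (lexx u) uw (ltW wv)).
    exact: closeness_le.
  have vw' : v <= w := le_trans (ltW vu) uw.
  apply/close_leS/(close_le_sub (ltW vu) uw (lexx w)).
  exact: closeness_le.
move=> xy yz; have [xz|zx] := GO_leVlt hGO x z; first exact: (main x y z).
by apply/closeness_sym/(main z y x); [exact: ltW|exact: closeness_sym..].
Qed.

Lemma nbhs_closeness n x : nbhs x (closeness n x).
Proof.
have [A [oA Ax cA AG]] := closed_discrete_convex hGO x (cG n).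
have [B [oB Bx cB BR]] := closed_discrete_convex hGO x (cR n).
have [C [oC Cx cC CL]] := closed_discrete_convex hGO x (cL n).
(* [A], [B], [C] exclude all points of [G n], [Rn n], [Ln n] except [x]; [M] keeps to one side of a
   cut at [x] itself. *)
have [M [xM MR ML]] : exists M : set X, [/\ nbhs x M,
    Rn n x -> M `<=` [set y | x <= y] & Ln n x -> M `<=` [set y | y <= x]].
  have RM : exists2 M : set X, nbhs x M & Rn n x -> M `<=` [set y | x <= y].
    have [Rx|] := pselect (Rn n x); last by exists setT => //; apply: filterT.
    exists [set y | x <= y]; last by move=> _ y.
    apply: open_nbhs_nbhs; split => //=.
    by suff : right_open x by []; rewrite RE; exists n.
  have LM : exists2 M : set X, nbhs x M & Ln n x -> M `<=` [set y | y <= x].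
    have [Lx|] := pselect (Ln n x); last by exists setT => //; apply: filterT.
    exists [set y | y <= x]; last by move=> _ y.
    apply: open_nbhs_nbhs; split => //=.
    by suff : left_open x by []; rewrite LE; exists n.
  have [[M xM MR] [M' xM' ML]] := (RM, LM); exists (M `&` M').
  by split; [exact: filterI|move=> /MR MR' y [/MR']|move=> /ML ML' y [_ /ML']].
apply: (@filterS _ _ _ (A `&` B `&` C `&` M)); last first.
  have oN E : open E -> E x -> nbhs x E by move=> *; apply: open_nbhs_nbhs.
  apply: filterI => //; apply: filterI; last exact: oN.
  by apply: filterI; exact: oN.
move=> y [[[Ay By] Cy] My]; have [xy|yx] := GO_leVlt hGO x y.
  left; split => // [p q Gp Gq xp py xq qy|p Rp xp py|p Lp xp py].
  - have pE : p = x by apply: AG => //; apply: (cA x y) => //; rewrite xp.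
    by rewrite pE (AG q)//; apply: (cA x y) => //; rewrite xq.
  - have px : p = x by apply: BR => //; apply: (cB x y) => //; rewrite ltW.
    by rewrite px ltxx in xp.
  - have px : p = x.
      by apply: CL => //; apply: (cC x y) => //; rewrite xp ltW.
    rewrite px in Lp py; have /= := ML Lp y My.
    by rewrite lt_geF.
right; split => [|p q Gp Gq yp px yq qx|p Rp yp px|p Lp yp px].
- exact: ltW.
- have pE : p = x by apply: AG => //; apply: (cA y x) => //; rewrite yp.
  by rewrite pE (AG q)//; apply: (cA y x) => //; rewrite yq.
- have pE : p = x.
    by apply: BR => //; apply: (cB y x) => //; rewrite px ltW.
  rewrite pE in Rp yp; have /= := MR Rp y My.
  by rewrite lt_geF.
- have pE : p = x by apply: CL => //; apply: (cC y x) => //; rewrite yp ltW.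
  by rewrite pE ltxx in px.
Qed.

Lemma closeness_base D x O : dense D -> D `<=` \bigcup_n G n -> nbhs x O ->
  exists n, closeness n x `<=` O.
Proof.
move=> dD DG xO; have [C [oC Cx cC CO]] := GO_convex_nbhs hGO xO.
have [i iC] : exists n, forall y, close_le n y x -> C y.
  have [|n nC] := left_ball hGO dD DG GS _ oC cC Cx (Rn := Rn).
    by rewrite RE.
  by exists n => y [yx Gy Ry _]; apply: nC.
have [j jC] : exists n, forall y, close_le n x y -> C y.
  (* The right rays of the dual order are the left rays of [X]. *)
  have LE' : (right_open : set (X^d)%type) `<=` \bigcup_n Ln n.
    by rewrite -LE.
  have cC' : @order_convex _ (X^d)%type C.
    move=> u v w Cu Cv /andP[wu vw].
    by apply: (cC v u) => //; apply/andP; split.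
  have [n nC] := @left_ball _ (X^d)%type D C G Ln x (GO_dual hGO) dD DG GS LE'
    oC cC' Cx.
  exists n => y [xy Gy _ Ly]; apply: nC => //.
  - by move=> p q Gp Gq py xp qy xq; apply: Gy.
  - by move=> p Lp py xp; apply: (Ly p).
have close_le_anti m n u v : (m <= n)%N -> close_le n u v -> close_le m u v.
  move=> /subnK <-; elim: (n - m)%N => [//|k IH]; rewrite addSn.
  by move=> /close_leS; apply: IH.
exists (maxn i j) => y [xy|yx]; apply: CO.
  exact/jC/(close_le_anti _ _ _ _ (leq_maxr i j)).
exact/iC/(close_le_anti _ _ _ _ (leq_maxl i j)).
Qed.

End Relation.

Lemma GO_metrizable D : dense D -> sigma_closed_discrete D ->
  sigma_closed_discrete (right_open : set X) ->
  sigma_closed_discrete (left_open : set X) -> metrizable R X.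
Proof.
have hX := GO_hausdorff hGO.
move=> dD [K cK DE] /(sigma_closed_discrete_nondecreasing hX)[Rn [cR RS RE]].
move=> /(sigma_closed_discrete_nondecreasing hX)[Ln [cL LS LE]].
have /choice[c0 c0P] : forall pq : X * X, exists c,
    (exists y, pq.1 < y /\ y < pq.2) -> pq.1 < c /\ c < pq.2.
  move=> pq; have [[y ?]|] := pselect (exists y, pq.1 < y /\ y < pq.2).
    by exists y.
  by exists pq.1.
pose c p q := c0 (p, q).
have cP p q : (exists y, p < y /\ y < q) -> p < c p q /\ c p q < q.
  exact: (c0P (p, q)).
(* Adding [K m] makes the union contain [D]; the midpoints serve [Gmid]. *)
pose G := fix G n : set X :=
  if n is m.+1 then G m `|` K m `|` midpoints c (G m) else set0.
have cG n : closed_discrete (G n).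
  elim: n => [|n IH] /=; first exact: closed_discrete0.
  apply: closed_discreteU => //; first exact: closed_discreteU.
  exact: closed_discrete_midpoints.
have GS n : G n `<=` G n.+1 by move=> x Gx; left; left.
have DG : D `<=` \bigcup_n G n.
  by rewrite DE => x [n _ Kx]; exists n.+1 => //; left; right.
have Gmid n p y q : G n p -> G n q -> p < y -> y < q ->
    exists c, [/\ G n.+1 c, p < c & c < q].
  move=> Gp Gq py yq.
  have [[g [Gg pg gq]]|ng] := pselect (exists g, [/\ G n g, p < g & g < q]).
    by exists g; split => //; apply: GS.
  have pq : exists y, p < y /\ y < q by exists y.
  have [pc cq] := cP p q pq; exists (c p q); split => //; right.
  exists p, q; split => // g Gg pg gq; apply: ng; by exists g.
(* Each composition costs one level and three factors need two compositions, so only every second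
   level is kept. *)
pose W n := closeness G Rn Ln n.*2.
have Wtrans := closeness_trans GS RS LS Gmid.
apply: (@metrizable_entourages R X W) => //.
- by move=> n x; apply: closeness_refl.
- by move=> n x y; apply: closeness_sym.
- move=> n x y z w; rewrite /W doubleS => xy yz zw.
  apply: (Wtrans _ _ z); first exact: Wtrans yz.
  exact: Wtrans zw (closeness_refl _ _ _ _ _).
- by move=> n x; apply: nbhs_closeness.
- move=> x O xO; have [n nO] := closeness_base GS RS LS RE LE dD DG xO.
  exists n => y xy; apply: nO; move: xy; rewrite /W -addnn.
  have anti k m : closeness G Rn Ln (k + m) x y -> closeness G Rn Ln m x y.
    elim: k => [//|k IH]; rewrite addSn => xy; apply: IH.
    exact: Wtrans xy (closeness_refl _ _ _ _ _).
  exact: anti.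
Qed.

End Entourages.

Theorem corollary1p5 (R : realType) (d : Order.disp_t)
    (X : POrderedTopological.type d) (hGO : GO_space X)
    (hD : exists2 D : set X, dense D & sigma_closed_discrete D) :
  [<-> monotonically_metacompact X;
       monotonically_countably_metacompact X;
       metrizable R X].
Proof.
have [D dD sD] := hD; split; [|split].
- move=> [r [r1 r2]]; exists r; split=> [U [cU _]|U V [cU _] [cV _]].
    exact: r1.
  exact: r2.
- move=> hr; apply: (GO_metrizable hGO dD sD).
    exact: right_open_sigma_closed_discrete hr dD sD.
  exact: (@right_open_sigma_closed_discrete _ (X^d)%type (GO_dual hGO) D).
- exact: metrizable_monotonically_metacompact.
Qed.
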